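(* Suppose we are given as input: (1) a finite symmetric set $X$ of automaton automorphisms of the tree $\mathcal T_d=C^*$, where $C=\{c_1,\dots,c_d\}$, $d\ge 2$; (2) a word $w\in X^*$ over the generating set $X$; and (3) two words $a,b\in C^*$ with $|b|\ge1$. Then it is computationally decidable whether $w\in\mathrm{WP}(\langle X\rangle,X,\mathrm{Stab}(ab^\omega))$. That is, the subgroup membership problem is solvable uniformly over all groups $G=\langle X\rangle$ generated by such sets $X$, and uniformly over all eventually periodic rays $\eta=ab^\omega$.
   Context: The vertices of the $d$-regular rooted tree $\mathcal T_d$ are the words in $C^*$; the root is the empty word and the children of $v$ are $vc_1,\dots,vc_d$. $\mathrm{Aut}(\mathcal T_d)$ is the group of rooted-tree automorphisms, acting on the right; the action extends to infinite rays (infinite words) in $C^\omega$. For $\alpha\in\mathrm{Aut}(\mathcal T_d)$ and $v\in C^*$, the section $\alpha@v$ is the unique automorphism with $(vu)\cdot\alpha=(v\cdot\alpha)(u\cdot(\alpha@v))$ for all $u\in C^*$. An automorphism $\alpha$ is an automaton automorphism if $\{\alpha@v:v\in C^*\}$ is finite; such an automorphism is determined by finite data (a finite automaton whose states are its sections) and is given as input in this form. For $G=\langle X\rangle$ and $\eta\in C^\omega$, $\mathrm{Stab}(\eta)=\{g\in G:\eta\cdot g=\eta\}$. For $w\in X^*$, $\overline w\in G$ is the product of its letters, and $\mathrm{WP}(G,X,H)=\{w\in X^*:\overline w\in H\}$ for a subgroup $H\le G$. *)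

(* Defs.v *)
From HB Require Import structures.
From mathcomp Require Import all_boot.
From mathcomp Require Import all_classical.

Set Implicit Arguments.
Unset Strict Implicit.
Unset Printing Implicit Defensive.

Local Open Scope classical_set_scope.

(** * Automorphisms of the d-regular rooted tree *)

Definition child d (v u : seq 'I_d) : bool := [exists c : 'I_d, u == rcons v c].

Definition tree_adj d (u v : seq 'I_d) : bool := child u v || child v u.

Record tree_aut d := TreeAut {
  tree_aut_fun :> seq 'I_d -> seq 'I_d;
  tree_aut_bij : bijective tree_aut_fun;
  tree_aut_root : tree_aut_fun [::] = [::];
  tree_aut_adj :
    forall u v, tree_adj (tree_aut_fun u) (tree_aut_fun v) = tree_adj u v }.

Lemma tree_aut_eq d (f g : tree_aut d) : (forall u, f u = g u) -> f = g.
Proof.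
case: f g => f bf rf af [g bg rg ag] /= /funext fg.
move: bf rf af bg rg ag; rewrite fg => *.
by congr TreeAut; exact: Prop_irrelevance.
Qed.

Section TreeAutTheory.
Variable d : nat.
Implicit Types (f g : tree_aut d) (u v : seq 'I_d).

Lemma tree_aut_rcons f v c : exists c', f (rcons v c) = rcons (f v) c'.
Proof.
elim/last_ind: v c => [|v x IH] c.
  have : tree_adj (f [::]) (f (rcons [::] c)).
    by rewrite tree_aut_adj; apply/orP; left; apply/existsP; exists c.
  rewrite tree_aut_root => /orP[] /existsP[c' /eqP E].
    by exists c'.
  by case: (f _) E.
have : tree_adj (f (rcons v x)) (f (rcons (rcons v x) c)).
  by rewrite tree_aut_adj; apply/orP; left; apply/existsP; exists c.
case/orP=> /existsP[c' /eqP E]; first by exists c'.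
have [y Ey] := IH x.
move: E; rewrite Ey => /rcons_inj[E _].
have /(congr1 size) := bij_inj (tree_aut_bij f) E.
by rewrite !size_rcons => /eqP; rewrite -addn2 -{1}[size v]addn0 eqn_add2l.
Qed.

Lemma size_tree_aut f v : size (f v) = size v.
Proof.
elim/last_ind: v => [|v c IH]; first by rewrite tree_aut_root.
by have [c' ->] := tree_aut_rcons f v c; rewrite !size_rcons IH.
Qed.

Lemma tree_aut_cat f v u : f (v ++ u) = f v ++ drop (size v) (f (v ++ u)).
Proof.
elim/last_ind: u => [|u c IH].
  by rewrite cats0 drop_oversize ?size_tree_aut// cats0.
rewrite -rcons_cat; have [c' ->] := tree_aut_rcons f (v ++ u) c.
rewrite -cats1 drop_cat size_tree_aut size_cat.
have := IH; case: ltnP => [_ {1}->|le IH']; first by rewrite catA.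
have u0 : u = [::].
  by apply/size0nil/eqP; rewrite -leqn0 -(leq_add2l (size v)) addn0.
by rewrite u0 cats0 addn0 subnn drop0.
Qed.

Lemma tree_adj_catl v u w : tree_adj (v ++ u) (v ++ w) = tree_adj u w.
Proof.
have H x y : child (v ++ x) (v ++ y) = child x y.
  by apply: eq_existsb => c; rewrite rcons_cat eqseq_cat// eqxx.
by rewrite /tree_adj !H.
Qed.

Lemma tree_aut_mul_root f g : (g \o f) [::] = [::].
Proof. by rewrite /= !tree_aut_root. Qed.

Lemma tree_aut_mul_adj f g u v :
  tree_adj ((g \o f) u) ((g \o f) v) = tree_adj u v.
Proof. by rewrite /= !tree_aut_adj. Qed.

Definition tree_aut_one : tree_aut d :=
  @TreeAut d id (inv_bij (fun=> erefl)) erefl (fun _ _ => erefl).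

(* The group law is written for the right action: u . (f g) = (u . f) . g. *)
Definition tree_aut_mul f g : tree_aut d :=
  TreeAut (bij_comp (tree_aut_bij g) (tree_aut_bij f))
    (tree_aut_mul_root f g) (tree_aut_mul_adj f g).

Lemma tree_aut_has_inv f : exists g : tree_aut d, cancel f g /\ cancel g f.
Proof.
have [h fK hK] := tree_aut_bij f.
have bh : bijective h by exists f.
have h0 : h [::] = [::] by apply: (can_inj fK); rewrite hK tree_aut_root.
have ha u v : tree_adj (h u) (h v) = tree_adj u v.
  by rewrite -(tree_aut_adj f) !hK.
by exists (TreeAut bh h0 ha).
Qed.

Definition tree_aut_inv f : tree_aut d := sval (cid (tree_aut_has_inv f)).

Lemma tree_aut_mulA : associative tree_aut_mul.
Proof. by move=> f g h; apply: tree_aut_eq. Qed.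

Lemma tree_aut_mul1g : left_id tree_aut_one tree_aut_mul.
Proof. by move=> f; apply: tree_aut_eq. Qed.

Lemma tree_aut_mulg1 : right_id tree_aut_one tree_aut_mul.
Proof. by move=> f; apply: tree_aut_eq. Qed.

Lemma tree_aut_mulVg : left_inverse tree_aut_one tree_aut_inv tree_aut_mul.
Proof.
move=> f; apply: tree_aut_eq => u /=; rewrite /tree_aut_inv.
by case: cid => g /= [].
Qed.

Lemma tree_aut_mulgV : right_inverse tree_aut_one tree_aut_inv tree_aut_mul.
Proof.
move=> f; apply: tree_aut_eq => u /=; rewrite /tree_aut_inv.
by case: cid => g /= [].
Qed.

End TreeAutTheory.

HB.instance Definition _ d := gen_eqMixin (tree_aut d).
HB.instance Definition _ d := gen_choiceMixin (tree_aut d).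
HB.instance Definition _ d := isGroup.Build (tree_aut d)
  (@tree_aut_mulA d) (@tree_aut_mul1g d) (@tree_aut_mulg1 d)
  (@tree_aut_mulVg d) (@tree_aut_mulgV d).

(** * Sections *)

Section TreeSection.
Variables (d : nat) (f : tree_aut d) (v : seq 'I_d).

Let sec (u : seq 'I_d) := drop (size v) (f (v ++ u)).

Lemma tree_section_bij : bijective sec.
Proof.
have [g [fK gK]] := tree_aut_has_inv f.
exists (fun u => drop (size v) (g (f v ++ u))) => u; rewrite /sec.
  by rewrite -tree_aut_cat fK drop_size_cat.
have := tree_aut_cat g (f v) u; rewrite fK size_tree_aut => <-.
by rewrite gK drop_size_cat ?size_tree_aut.
Qed.

Lemma tree_section_root : sec [::] = [::].
Proof. by rewrite /sec cats0 drop_oversize ?size_tree_aut. Qed.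

Lemma tree_section_adj u w : tree_adj (sec u) (sec w) = tree_adj u w.
Proof. by rewrite -(tree_adj_catl (f v)) -!tree_aut_cat tree_aut_adj tree_adj_catl. Qed.

Definition tree_section : tree_aut d :=
  TreeAut tree_section_bij tree_section_root tree_section_adj.

End TreeSection.

Notation "f @@ v" := (tree_section f v) (at level 30, no associativity).

Lemma tree_sectionE d (f : tree_aut d) (v u : seq 'I_d) :
  f (v ++ u) = f v ++ (f @@ v) u.
Proof. exact: tree_aut_cat. Qed.

Lemma tree_section_unique d (f g : tree_aut d) (v : seq 'I_d) :
  (forall u, f (v ++ u) = f v ++ g u) -> g = f @@ v.
Proof. by move=> H; apply: tree_aut_eq => u /=; rewrite H drop_size_cat ?size_tree_aut. Qed.

Lemma tree_section0 d (f : tree_aut d) : f @@ [::] = f.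
Proof. by apply: tree_aut_eq => u /=; rewrite drop0. Qed.

Lemma tree_section_cat d (f : tree_aut d) (v u : seq 'I_d) :
  (f @@ v) @@ u = f @@ (v ++ u).
Proof.
apply: tree_section_unique => w.
by rewrite -catA !tree_sectionE catA.
Qed.

Definition sections d (f : tree_aut d) : set (tree_aut d) :=
  range (fun v => f @@ v).

Definition automaton_automorphism d (f : tree_aut d) : Prop :=
  finite_set (sections f).

(** * Automata *)

Record automaton d := Automaton {
  nstates : nat;
  init : 'I_nstates;
  next : 'I_nstates -> 'I_d -> 'I_nstates;
  output : 'I_nstates -> 'I_d -> 'I_d }.

(* The states of A are the sections of f: [st] names the section attached to
   each state, two states being allowed to carry the same section. *)
Definition presents d (A : automaton d) (f : tree_aut d) : Prop :=
  exists st : 'I_(nstates A) -> tree_aut d,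
    [/\ st (init A) = f,
        range st = sections f
      & forall q c, st q [:: c] = [:: output q c]
                    /\ st q @@ [:: c] = st (next q c)].

Lemma automaton_automorphismP d (f : tree_aut d) :
  automaton_automorphism f <-> exists A, presents A f.
Proof.
split=> [/finite_seqP[s Es]|[A [st [_ Est _]]]]; last first.
  by rewrite /automaton_automorphism -Est; apply: finite_image; exact: finite_finset.
have memP g : sections f g <-> g \in s by rewrite Es.
have fs : f \in s by apply/memP; exists [::] => //; exact: tree_section0.
pose st (q : 'I_(size s)) := nth f s q.
have st_in q : st q \in s by exact: mem_nth.
have sec_in q c : st q @@ [:: c] \in s.
  have /memP[v _ <-] := st_in q; apply/memP.
  by exists (v ++ [:: c]) => //; rewrite tree_section_cat.
have idx_lt g : g \in s -> index g s < size s by rewrite index_mem.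
pose A := @Automaton d (size s) (Ordinal (idx_lt _ fs))
  (fun q c => Ordinal (idx_lt _ (sec_in q c))) (fun q c => last c (st q [:: c])).
exists A, st; split=> [||q c] /=.
- by rewrite /st /= nth_index.
- apply/seteqP; split=> [g [q _ <-]|g /memP gs]; first exact/memP.
  by exists (Ordinal (idx_lt _ gs)) => //; rewrite /st /= nth_index.
- split; last by rewrite [RHS]/st /= nth_index.
  by have := size_tree_aut (st q) [:: c]; case: (st q _) => [|x []].
Qed.

(** * Rays *)

Definition ray d := nat -> 'I_d.

Definition ray_act d (eta : ray d) (f : tree_aut d) : ray d :=
  fun n => nth (eta n) (f (mkseq eta n.+1)) n.

Lemma mkseq_ray_act d (eta : ray d) (f : tree_aut d) n :
  mkseq (ray_act eta f) n = f (mkseq eta n).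
Proof.
have S (e : ray d) m : mkseq e m.+1 = rcons (mkseq e m) (e m).
  by rewrite /mkseq -{1}addn1 iotaD map_cat /= cats1.
elim: n => [|n IH]; first by rewrite tree_aut_root.
rewrite [LHS]S IH /ray_act S.
have [c ->] := tree_aut_rcons f (mkseq eta n) (eta n).
by rewrite nth_rcons size_tree_aut size_mkseq ltnn eqxx.
Qed.

(* The ray a b^omega *)
Definition evper_ray d (a b : seq 'I_d) (b_gt0 : 0 < size b) : ray d :=
  let c0 := tnth (in_tuple b) (Ordinal b_gt0) in
  fun n => if n < size a then nth c0 a n
           else nth c0 b ((n - size a) %% size b).

(** * Generated subgroups, stabilisers and words *)

Section Subgroups.
Local Open Scope group_scope.

Definition is_subgroup (G : groupType) (H : set G) : Prop :=
  [/\ H 1, forall x y, H x -> H y -> H (x * y) & forall x, H x -> H x^-1].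

Definition gen_subgroup (G : groupType) (X : set G) : set G :=
  smallest (@is_subgroup G) X.

Definition symmetric_set (G : groupType) (X : set G) : Prop :=
  forall x, X x -> X x^-1.

Definition Stab d (G : set (tree_aut d)) (eta : ray d) : set (tree_aut d) :=
  [set g | G g /\ ray_act eta g = eta].

(* A word over the enumerated set X is the sequence of indices of its letters. *)
Definition word_value (G : groupType) k (X : 'I_k -> G) (w : seq 'I_k) : G :=
  \prod_(i <- w) X i.

Definition WP (G : groupType) k (X : 'I_k -> G) (H : set G) : set (seq 'I_k) :=
  [set w | H (word_value X w)].

End Subgroups.

(** * Partial recursive functions *)

Inductive recfun : nat -> Type :=
| RZero n : recfun n
| RSucc : recfun 1
| RProj n (i : 'I_n) : recfun n
| RComp m n (g : recfun m) (h : 'I_m -> recfun n) : recfun n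
| RRec n (g : recfun n) (h : recfun n.+2) : recfun n.+1
| RMin n (g : recfun n.+1) : recfun n.

(* [reval f v y]: the computation of f on v halts with value y. *)
Fixpoint reval n (f : recfun n) : n.-tuple nat -> nat -> Prop :=
  match f in recfun n return n.-tuple nat -> nat -> Prop with
  | RZero _ => fun v y => y = 0
  | RSucc => fun v y => y = (thead v).+1
  | RProj _ i => fun v y => y = tnth v i
  | RComp m _ g h => fun v y =>
      exists us : m.-tuple nat,
        (forall i, reval (h i) v (tnth us i)) /\ reval g us y
  | RRec _ g h => fun v =>
      let x := behead_tuple v in
      let fix iterate k y := match k with
        | 0 => reval g x y
        | k'.+1 => exists z, iterate k' z /\ reval h [tuple of k' :: z :: x] y
        end in iterate (thead v)
  | RMin _ g => fun v y =>
      reval g [tuple of y :: v] 0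
      /\ forall i, i < y -> exists z, reval g [tuple of i :: v] z.+1
  end.

Lemma reval_inj n (f : recfun n) v y z : reval f v y -> reval f v z -> y = z.
Proof.
elim: n / f v y z => /= [n v y z -> //|v y z -> //|n i v y z -> //||n g IHg h IHh|].
- move=> m n g IHg h IHh v y z [us [Hu Hy]] [us' [Hu' Hz]].
  have E : us = us' by apply: eq_from_tnth => i; exact: IHh (Hu i) (Hu' i).
  by move: Hz; rewrite -E; exact: IHg.
- move=> v; elim: (thead v) => [|k IH] y z; first exact: IHg.
  move=> [y' [/IH Hy' Hy]] [z' [/Hy' E Hz]].
  by move: Hz; rewrite -E; exact: IHh.
- move=> n g IHg v y z [Hy Ly] [Hz Lz].
  case: (ltngtP y z) => // [/Lz|/Ly] [x Hx].
    by have := IHg _ _ _ Hy Hx.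
  by have := IHg _ _ _ Hz Hx.
Qed.

Definition decides_at (f : recfun 1) (n : nat) (P : Prop) : Prop :=
  (P -> reval f [tuple n] 1) /\ (~ P -> reval f [tuple n] 0).

(** * Encoding of the inputs *)

Definition cantor_pair (x y : nat) : nat := ((x + y) * (x + y).+1)./2 + y.

Definition code_seq (s : seq nat) : nat :=
  foldr (fun x c => (cantor_pair x c).+1) 0 s.

Lemma cantor_pair_inj x y x' y' :
  cantor_pair x y = cantor_pair x' y' -> x = x' /\ y = y'.
Proof.
pose T n := (n * n.+1)./2.
have TS n : T n.+1 = T n + n.+1.
  rewrite /T mulnC (_ : n.+2 * n.+1 = n * n.+1 + n.+1.*2).
    by rewrite halfD odd_double andbF doubleK.
  by rewrite -[n.+2]addn2 mulnDl mul2n.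
have Tle m n : m <= n -> T m <= T n.
  move/subnKC <-; elim: (n - m) => [|k IH]; first by rewrite addn0.
  by rewrite addnS TS (leq_trans IH)// leq_addr.
have lt a b a' b' : a + b < a' + b' -> T (a + b) + b < T (a' + b') + b'.
  move=> /Tle; rewrite TS => H; apply: leq_trans (leq_trans H (leq_addr _ _)).
  by rewrite ltn_add2l ltnS leq_addl.
rewrite /cantor_pair -/(T _) -/(T _) => E.
case: (ltngtP (x + y) (x' + y')) => [/lt|/lt|S]; rewrite ?E ?ltnn//.
move: E; rewrite S => /addnI yy'; split=> //.
by move: S; rewrite yy' => /addIn.
Qed.

Lemma code_seq_inj : injective code_seq.
Proof.
by elim=> [|x s IH] [|y t] //= [] /cantor_pair_inj[-> /IH ->].
Qed.

Definition code_word d (u : seq 'I_d) : nat := code_seq [seq val c | c <- u].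

Definition code_automaton d (A : automaton d) : nat :=
  code_seq [:: nstates A; val (init A);
    code_seq [seq code_seq [seq cantor_pair (next q c) (output q c)
                           | c <- enum 'I_d]
             | q <- enum 'I_(nstates A)]].

Definition code_input d k (A : 'I_k -> automaton d)
    (w : seq 'I_k) (a b : seq 'I_d) : nat :=
  code_seq [:: d; code_seq [seq code_automaton (A i) | i <- enum 'I_k];
               code_word w; code_word a; code_word b].

(* Main.v *)
Require Import Defs.
From mathcomp Require Import all_boot.
From mathcomp Require Import all_classical.
From mathcomp Require Import zify.

(* Let g be the value of w and eta = a b^omega.  The sections of g are products
   of sections of the letters, so there are at most K ^ |w| of them, where K
   bounds the number of states of the given automata.  The section of g at
   a b^j determines the one at a b^(j+1), hence g fixes eta as soon as it fixes
   the prefix of eta of length |a| + K ^ |w| |b|.  The code n of the input bounds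
   all of |a|, |b|, |w| and K, so it suffices to run the transducers on the prefix
   of length n + n * n ^ n, which is a primitive recursive computation. *)

Set Implicit Arguments.
Unset Strict Implicit.
Unset Printing Implicit Defensive.

(** * Total recursive functions *)

(* F is only meant to be applied to sequences of size n; plain sequences avoid
   dependent types in the arguments. *)
Definition computable n (F : seq nat -> nat) : Prop :=
  exists f : recfun n, forall v : n.-tuple nat, reval f v (F (tval v)).

Lemma eq_computable n (F G : seq nat -> nat) :
  (forall v : n.-tuple nat, F (tval v) = G (tval v)) -> computable n F -> computable n G.
Proof. by move=> FG [f Hf]; exists f => v; rewrite -FG. Qed.

Lemma computable_proj n i : i < n -> computable n (fun v => nth 0 v i).
Proof. by move=> i_n; exists (RProj (Ordinal i_n)) => v /=; rewrite (tnth_nth 0). Qed.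

Lemma computable_const n c : computable n (fun=> c).
Proof.
elim: c => [|c [f Hf]]; first by exists (RZero n).
exists (RComp RSucc (fun=> f)) => v; exists [tuple c]; split=> // i.
by rewrite ord1.
Qed.

Definition computable1 (g : nat -> nat) := computable 1 (fun v => g (nth 0 v 0)).

Definition computable2 (g : nat -> nat -> nat) :=
  computable 2 (fun v => g (nth 0 v 0) (nth 0 v 1)).

Lemma computable_comp1 n g F :
  computable1 g -> computable n F -> computable n (fun v => g (F v)).
Proof.
move=> [g' Hg] [f Hf]; exists (RComp g' (fun=> f)) => v.
exists [tuple F v]; split=> [i|]; last exact: (Hg [tuple F v]).
by rewrite ord1.
Qed.

Lemma computable_comp2 n g F1 F2 :
  computable2 g -> computable n F1 -> computable n F2 ->
  computable n (fun v => g (F1 v) (F2 v)).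
Proof.
move=> [g' Hg] [f1 Hf1] [f2 Hf2].
exists (RComp g' (fun i : 'I_2 => if val i == 0 then f1 else f2)) => v.
exists [tuple F1 v; F2 v]; split; last exact: (Hg [tuple F1 v; F2 v]).
by case=> [[|[|//]]] /= lt_i2; rewrite (tnth_nth 0).
Qed.

(** [F] enters through its recursion equations, so known functions can be used as they stand; the
    step takes counter, previous value and parameters in the order of [RRec]. *)
Lemma computable_rec n (F : nat -> seq nat -> nat) G H :
  computable n G -> computable n.+2 H ->
  (forall x, F 0 x = G x) -> (forall k x, F k.+1 x = H [:: k, F k x & x]) ->
  computable n.+1 (fun v => F (head 0 v) (behead v)).
Proof.
move=> [g Hg] [h Hh] F0 FS; exists (RRec g h) => v /=.
have -> : head 0 v = thead v by rewrite /thead (tnth_nth 0) nth0.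
elim: (thead v) => [|k IH]; first by rewrite F0; exact: (Hg (behead_tuple v)).
exists (F k (behead v)); split=> //.
by rewrite FS; apply: (Hh [tuple of k :: F k (behead v) :: behead_tuple v]).
Qed.

Lemma computable1_rec (F : nat -> nat) c h :
  computable2 h -> F 0 = c -> (forall k, F k.+1 = h k (F k)) -> computable1 F.
Proof.
move=> Hh F0 FS; rewrite /computable1.
apply: eq_computable (computable_rec (F := fun k _ => F k) (computable_const 0 c) Hh _ _) => //.
Qed.

Lemma computable2_rec (F : nat -> nat -> nat) g h :
  computable1 g -> computable2 h ->
  (forall x, F 0 x = g x) -> (forall k x, F k.+1 x = h (F k x) x) -> computable2 F.
Proof.
move=> Hg Hh F0 FS.
have Hh3 : computable 3 (fun v => h (nth 0 v 1) (nth 0 v 2)).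
  exact: computable_comp2 (computable_proj _) (computable_proj _).
apply: eq_computable (computable_rec (F := fun k x => F k (nth 0 x 0)) Hg Hh3 _ _) => //.
by move=> v; rewrite nth_behead nth0.
Qed.

Lemma computable2_swap g : computable2 g -> computable2 (fun x y => g y x).
Proof. by move=> Hg; apply: computable_comp2 Hg _ _; apply: computable_proj. Qed.

Lemma computable2_id1 : computable2 (fun x _ => x).
Proof. exact: computable_proj. Qed.

Lemma computable2_id2 : computable2 (fun _ y => y).
Proof. exact: computable_proj. Qed.

Lemma computable1_id : computable1 (fun x => x).
Proof. exact: computable_proj. Qed.

Lemma computable1_const c : computable1 (fun=> c).
Proof. exact: computable_const. Qed.

Lemma computable1_succ : computable1 S.
Proof.
by exists RSucc => v /=; rewrite /thead (tnth_nth 0).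
Qed.

Lemma computable1_pred : computable1 predn.
Proof. exact: (computable1_rec computable2_id1). Qed.

Lemma computable2_add : computable2 addn.
Proof.
apply: (@computable2_rec _ id (fun z _ => z.+1)) => //.
- exact: computable1_id.
- exact: computable_comp1 computable1_succ computable2_id1.
Qed.

Lemma computable2_mul : computable2 muln.
Proof.
apply: (@computable2_rec _ (fun=> 0) (fun z x => x + z)) => //.
- exact: computable1_const.
- exact: computable2_swap computable2_add.
Qed.

Lemma computable2_sub : computable2 subn.
Proof.
(* Truncated subtraction recurses on its second argument, the recursion scheme on the first. *)
apply: (@computable2_swap (fun x y => y - x)).
apply: (@computable2_rec _ id (fun z _ => z.-1)) => //.
- exact: computable1_id.
- exact: computable_comp1 computable1_pred computable2_id1.
- exact: subn0.
- by move=> k x; rewrite subnS.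
Qed.

Lemma computable2_iter h : computable1 h -> computable2 (fun m z => iter m h z).
Proof.
move=> Hh; apply: (@computable2_rec _ id (fun z _ => h z)) => //.
- exact: computable1_id.
- exact: computable_comp1 Hh computable2_id1.
Qed.

(** * The Cantor pairing and its inverse *)

Definition triangle n := (n * n.+1)./2.

Lemma triangleS n : triangle n.+1 = triangle n + n.+1.
Proof.
rewrite /triangle (_ : n.+1 * n.+2 = n * n.+1 + n.+1.*2); last by lia.
by rewrite halfD odd_double andbF doubleK.
Qed.

Lemma leq_triangle m n : m <= n -> triangle m <= triangle n.
Proof.
move/subnKC <-; elim: (n - m) => [|k IH]; first by rewrite addn0.
by rewrite addnS triangleS (leq_trans IH) ?leq_addr.
Qed.

Lemma leq_triangle_self n : n <= triangle n.
Proof. by elim: n => // n _; rewrite triangleS leq_addl. Qed.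

Lemma computable1_triangle : computable1 triangle.
Proof.
apply: (@computable1_rec _ 0 (fun k z => z + k.+1)) => //; last exact: triangleS.
exact: computable_comp2 computable2_add computable2_id2
  (computable_comp1 computable1_succ computable2_id1).
Qed.

(* The largest s with [triangle s <= n]; for n = cantor_pair x y it is x + y. *)
Fixpoint triangle_root n :=
  if n is m.+1 then
    let s := triangle_root m in s + (1 - (triangle s.+1 - m.+1))
  else 0.

(** Passing from [n] to [n.+1] raises the root [s] by at most one, and the truncated expression
    [1 - (triangle s.+1 - n.+1)] is 1 exactly when it rises. *)
Lemma triangle_rootP n :
  triangle (triangle_root n) <= n < triangle (triangle_root n).+1.
Proof.
elim: n => // n; rewrite [triangle_root n.+1]/=.
move: (triangle_root n) => s /andP[le_n n_lt].
case: (leqP (triangle s.+1) n.+1) => [le|lt].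
  have := triangleS s.+1.
  rewrite (eqP le) subn0 addn1; lia.
have -> : 1 - (triangle s.+1 - n.+1) = 0 by lia.
by rewrite addn0; lia.
Qed.

Lemma computable1_triangle_root : computable1 triangle_root.
Proof.
apply: (@computable1_rec _ 0 (fun k s => s + (1 - (triangle s.+1 - k.+1)))) => //.
apply: computable_comp2 computable2_add computable2_id2 _.
apply: computable_comp2 computable2_sub (computable_const _ 1) _.
apply: computable_comp2 computable2_sub _ _; last first.
  exact: computable_comp1 computable1_succ computable2_id1.
apply: computable_comp1 computable1_triangle _.
exact: computable_comp1 computable1_succ computable2_id2.
Qed.

Definition unpair2 n := n - triangle (triangle_root n).
Definition unpair1 n := triangle_root n - unpair2 n.

(** As [y <= x + y], the code lies in the interval from [triangle (x + y)] up to, but excluding,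
    [triangle (x + y).+1]; monotonicity then determines the root. *)
Lemma triangle_root_pair x y : triangle_root (cantor_pair x y) = x + y.
Proof.
have := triangle_rootP (cantor_pair x y).
rewrite {2 3}/cantor_pair -/(triangle (x + y)).
set s := triangle_root _ => /andP[le_s s_lt].
case: (ltngtP s (x + y)) => // [lt|gt].
  have := leq_triangle lt; lia.
have := leq_triangle gt; rewrite triangleS; lia.
Qed.

Lemma cantor_pairK2 x y : unpair2 (cantor_pair x y) = y.
Proof. by rewrite /unpair2 triangle_root_pair addKn. Qed.

Lemma cantor_pairK1 x y : unpair1 (cantor_pair x y) = x.
Proof. by rewrite /unpair1 cantor_pairK2 triangle_root_pair addnK. Qed.

Lemma leq_cantor_pair1 x y : x <= cantor_pair x y.
Proof.
rewrite /cantor_pair -/(triangle (x + y)).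
by have := leq_triangle_self (x + y); lia.
Qed.

Lemma leq_cantor_pair2 x y : y <= cantor_pair x y.
Proof. exact: leq_addl. Qed.

(** * Closure properties of computable unary functions *)

Section Closure.
Implicit Types F G C : nat -> nat.

Lemma computable1_succ_comp F : computable1 F -> computable1 (fun x => (F x).+1).
Proof. exact: computable_comp1 computable1_succ. Qed.

Lemma computable1_pred_comp F : computable1 F -> computable1 (fun x => (F x).-1).
Proof. exact: computable_comp1 computable1_pred. Qed.

Lemma computable1_add F G :
  computable1 F -> computable1 G -> computable1 (fun x => F x + G x).
Proof. exact: computable_comp2 computable2_add. Qed.

Lemma computable1_sub F G :
  computable1 F -> computable1 G -> computable1 (fun x => F x - G x).
Proof. exact: computable_comp2 computable2_sub. Qed.

Lemma computable1_mul F G :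
  computable1 F -> computable1 G -> computable1 (fun x => F x * G x).
Proof. exact: computable_comp2 computable2_mul. Qed.

Lemma computable1_unpair2 F : computable1 F -> computable1 (fun x => unpair2 (F x)).
Proof.
move=> HF; apply: computable1_sub => //.
exact: computable_comp1 computable1_triangle (computable_comp1 computable1_triangle_root HF).
Qed.

Lemma computable1_unpair1 F : computable1 F -> computable1 (fun x => unpair1 (F x)).
Proof.
move=> HF; apply: computable1_sub; last exact: computable1_unpair2.
exact: computable_comp1 computable1_triangle_root HF.
Qed.

Lemma computable1_pair F G :
  computable1 F -> computable1 G -> computable1 (fun x => cantor_pair (F x) (G x)).
Proof.
move=> HF HG; apply: computable1_add => //.
by apply: computable_comp1 computable1_triangle _; apply: computable1_add.
Qed.

(* The parameter x of the iterated function is carried along in the state. *)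
Lemma computable1_iter N F H :
  computable1 N -> computable1 F ->
  computable1 (fun p => H (unpair1 p) (unpair2 p)) ->
  computable1 (fun x => iter (N x) (H x) (F x)).
Proof.
move=> HN HF HH.
pose step p := cantor_pair (unpair1 p) (H (unpair1 p) (unpair2 p)).
have stepE m x z : iter m step (cantor_pair x z) = cantor_pair x (iter m (H x) z).
  by elim: m => //= m ->; rewrite /step cantor_pairK1 cantor_pairK2.
have Hstep : computable1 step.
  exact: computable1_pair (computable1_unpair1 computable1_id) HH.
apply: (@eq_computable _ (fun v => unpair2
    (iter (N (nth 0 v 0)) step (cantor_pair (nth 0 v 0) (F (nth 0 v 0)))))).
  by move=> v; rewrite stepE cantor_pairK2.
apply: (@computable1_unpair2 (fun x => iter (N x) step (cantor_pair x (F x)))).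
apply: computable_comp2 (computable2_iter Hstep) HN _.
exact: computable1_pair computable1_id HF.
Qed.

(** A case distinction is an iteration: the constant map to [G x], applied [C x] times from [F x],
    gives [F x] for zero applications and [G x] otherwise. *)
Lemma computable1_if C F G :
  computable1 C -> computable1 F -> computable1 G ->
  computable1 (fun x => if C x == 0 then F x else G x).
Proof.
move=> HC HF HG.
apply: (@eq_computable _ (fun v => let x := nth 0 v 0 in
    iter (C x) (fun=> G x) (F x))) => [v /=|].
  by case: (C _).
apply: (@computable1_iter C F (fun x _ => G x)) => //.
exact: computable_comp1 HG (computable1_unpair1 computable1_id).
Qed.

Lemma computable1_comp F G :
  computable1 F -> computable1 G -> computable1 (fun x => F (G x)).
Proof. exact: computable_comp1. Qed.

End Closure.

(** * Computing with coded sequences *)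

(* On the code 0 of the empty sequence, [code_head] and [code_behead] return 0. *)
Definition code_head c := unpair1 c.-1.
Definition code_behead c := unpair2 c.-1.
Definition code_cons x c := (cantor_pair x c).+1.
Definition code_nth i c := code_head (iter i code_behead c).

(* The code of a sequence exceeds its size, so it serves as fuel. *)
Definition code_foldl (h : nat -> nat -> nat) acc c :=
  unpair2 (iter c
    (fun z => if unpair1 z == 0 then z
              else cantor_pair (code_behead (unpair1 z))
                     (h (unpair2 z) (code_head (unpair1 z))))
    (cantor_pair c acc)).

Definition code_rev c := code_foldl (fun acc x => code_cons x acc) 0 c.

Lemma code_head_cons x s : code_head (code_seq (x :: s)) = x.
Proof. exact: cantor_pairK1. Qed.

Lemma code_behead_cons x s : code_behead (code_seq (x :: s)) = code_seq s.
Proof. exact: cantor_pairK2. Qed.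

Lemma code_nthE i s : i < size s -> code_nth i (code_seq s) = nth 0 s i.
Proof.
rewrite /code_nth; elim: i s => [|i IH] [|x s] //= lt_is; first exact: code_head_cons.
by rewrite -iterS iterSr -/(code_seq (x :: s)) code_behead_cons IH.
Qed.

(** Each entry adds a successor. The bound justifies the fuel of [code_foldl] and later bounds word
    lengths by the input code. *)
Lemma size_code_seq s : size s <= code_seq s.
Proof. by elim: s => //= x s IH; rewrite ltnS (leq_trans IH)// leq_cantor_pair2. Qed.

Lemma mem_code_seq x s : x \in s -> x < code_seq s.
Proof.
elim: s => //= y s IH; rewrite inE ltnS => /predU1P[->|/IH /ltnW xs].
  exact: leq_cantor_pair1.
exact: leq_trans xs (leq_cantor_pair2 _ _).
Qed.

Lemma code_foldlE h acc s : code_foldl h acc (code_seq s) = foldl h acc s.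
Proof.
rewrite /code_foldl; set step := fun z => _.
(* The fuel is generalised to any bound on the length: once the sequence is exhausted, with code 0,
   the step changes nothing. *)
suff E n : size s <= n -> iter n step (cantor_pair (code_seq s) acc)
    = cantor_pair 0 (foldl h acc s).
  by rewrite E ?cantor_pairK2// size_code_seq.
elim: n s acc => [|n IH] [|x s] acc //.
  by rewrite iterSr => _; rewrite {2}/step cantor_pairK1 eqxx; apply: IH.
by move=> sn; rewrite iterSr {2}/step cantor_pairK1 cantor_pairK2
  code_behead_cons code_head_cons; apply: IH.
Qed.

Lemma code_revE s : code_rev (code_seq s) = code_seq (rev s).
Proof.
rewrite /code_rev code_foldlE /rev -[0]/(code_seq [::]).
by elim: s [::] => //= x s IH t; rewrite -IH.
Qed.

Lemma computable1_head F : computable1 F -> computable1 (fun x => code_head (F x)).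
Proof. by move=> HF; apply: computable1_unpair1; apply: computable1_pred_comp. Qed.

Lemma computable1_behead F : computable1 F -> computable1 (fun x => code_behead (F x)).
Proof. by move=> HF; apply: computable1_unpair2; apply: computable1_pred_comp. Qed.

Lemma computable1_cons F G :
  computable1 F -> computable1 G -> computable1 (fun x => code_cons (F x) (G x)).
Proof. by move=> HF HG; apply: computable1_succ_comp; apply: computable1_pair. Qed.

Lemma computable1_nth F G :
  computable1 F -> computable1 G -> computable1 (fun x => code_nth (F x) (G x)).
Proof.
move=> HF HG; apply: computable1_head.
apply: (@computable1_iter F G (fun=> code_behead)) => //.
apply: computable1_behead; exact: computable1_unpair2 computable1_id.
Qed.

(** Parameter, accumulator and entry are packed by nested pairs, so that unary computability
    suffices for [H]. *)
Lemma computable1_foldl (H : nat -> nat -> nat -> nat) A C :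
  computable1 (fun p => H (unpair1 p) (unpair1 (unpair2 p)) (unpair2 (unpair2 p))) ->
  computable1 A -> computable1 C ->
  computable1 (fun x => code_foldl (H x) (A x) (C x)).
Proof.
move=> HH HA HC; apply: computable1_unpair2.
pose step x z := if unpair1 z == 0 then z
  else cantor_pair (code_behead (unpair1 z)) (H x (unpair2 z) (code_head (unpair1 z))).
have id1 := computable1_id.
have u1 := computable1_unpair1; have u2 := computable1_unpair2.
apply: (@computable1_iter C (fun x => cantor_pair (C x) (A x)) step) => //.
  exact: computable1_pair.
apply: (@computable1_if (fun p => unpair1 (unpair2 p)) (fun p => unpair2 p)).
- by auto.
- by auto.
apply: computable1_pair; first by apply: computable1_behead; auto.
(* The state (parameter, (rest, accumulator)) is repacked as (parameter, (accumulator, first entry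
   of the rest)). *)
pose arg p := cantor_pair (unpair1 p)
  (cantor_pair (unpair2 (unpair2 p)) (code_head (unpair1 (unpair2 p)))).
have Harg : computable1 arg.
  by do 2![apply: computable1_pair; auto]; apply: computable1_head; auto.
apply: eq_computable (computable1_comp HH Harg) => v.
by rewrite /arg !(cantor_pairK1, cantor_pairK2).
Qed.

Lemma computable1_rev F : computable1 F -> computable1 (fun x => code_rev (F x)).
Proof.
move=> HF; apply: (@computable1_foldl (fun _ acc x => code_cons x acc)) => //.
  by apply: computable1_cons; do !apply: computable1_unpair1 || apply: computable1_unpair2;
     exact: computable1_id.
exact: computable1_const.
Qed.

(** * The decision procedure *)

(* The state is the pair of the automaton state and the reversed output; entries 1
   and 2 of the code of an automaton are its initial state and its table. *)
Definition code_transduce A u :=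
  code_rev (unpair2 (code_foldl
    (fun z c =>
       cantor_pair (unpair1 (code_nth c (code_nth (unpair1 z) (code_nth 2 A))))
         (code_cons (unpair2 (code_nth c (code_nth (unpair1 z) (code_nth 2 A))))
            (unpair2 z)))
    (cantor_pair (code_nth 1 A) 0) u)).

(* The state is the pair of the letters left before the next period and the
   reversed output; an exhausted word is replaced by b. *)
Definition code_prefix m a b :=
  code_rev (unpair2 (iter m
    (fun z =>
       cantor_pair (code_behead (if unpair1 z == 0 then b else unpair1 z))
         (code_cons (code_head (if unpair1 z == 0 then b else unpair1 z))
            (unpair2 z)))
    (cantor_pair a 0))).

(** The power [n ^ n] is written as an iteration so that [computable1_iter] applies. *)
Definition decision_length n := n + n * iter n (muln n) 1.

(* The entries 1, 2, 3, 4 of the input code the automata, w, a and b. *)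
Definition decision_prefix n :=
  code_prefix (decision_length n) (code_nth 3 n) (code_nth 4 n).

(** A left fold, since under the right action the first letter of the word acts first. *)
Definition decision_image n :=
  code_foldl (fun u i => code_transduce (code_nth i (code_nth 1 n)) u)
    (decision_prefix n) (code_nth 2 n).

(** With truncated subtraction the sum of both differences vanishes exactly for equal codes; the
    value is then 1, and 0 otherwise. *)
Definition decision n :=
  1 - ((decision_image n - decision_prefix n) + (decision_prefix n - decision_image n)).

(* Computability of the decision procedure *)
Create HintDb computable.
Hint Resolve computable1_id computable1_const computable1_pair computable1_cons
  computable1_nth computable1_unpair1 computable1_unpair2 computable1_head
  computable1_behead computable1_rev computable1_if computable1_add
  computable1_sub computable1_mul computable1_foldl computable1_iter : computable.

Lemma computable1_transduce F G : computable1 F -> computable1 G ->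
  computable1 (fun x => code_transduce (F x) (G x)).
Proof.
move=> HF HG; apply: computable1_rev; apply: computable1_unpair2.
apply: (@computable1_foldl (fun x z c =>
       cantor_pair (unpair1 (code_nth c (code_nth (unpair1 z) (code_nth 2 (F x)))))
         (code_cons (unpair2 (code_nth c (code_nth (unpair1 z) (code_nth 2 (F x)))))
            (unpair2 z)))); auto with computable.
(* The automaton depends on the parameter of the fold, which is the first component of the packed
   argument. *)
have HF1 : computable1 (fun p => F (unpair1 p)).
  by apply: computable1_comp => //; auto with computable.
by auto 20 with computable.
Qed.

Lemma computable1_prefix F G H : computable1 F -> computable1 G -> computable1 H ->
  computable1 (fun x => code_prefix (F x) (G x) (H x)).
Proof.
move=> HF HG HH; apply: computable1_rev; apply: computable1_unpair2.
apply: (@computable1_iter _ _ (fun x z =>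
       cantor_pair (code_behead (if unpair1 z == 0 then H x else unpair1 z))
         (code_cons (code_head (if unpair1 z == 0 then H x else unpair1 z))
            (unpair2 z)))); auto with computable.
have HH1 : computable1 (fun p => H (unpair1 p)).
  by apply: computable1_comp => //; auto with computable.
by auto 20 with computable.
Qed.

Lemma computable1_decision_prefix : computable1 decision_prefix.
Proof.
apply: computable1_prefix; auto with computable.
apply: computable1_add; auto with computable.
Qed.

Lemma computable1_decision_image : computable1 decision_image.
Proof.
apply: (@computable1_foldl (fun n u i => code_transduce (code_nth i (code_nth 1 n)) u)).
- by apply: computable1_transduce; auto 10 with computable.
- exact: computable1_decision_prefix.
- by auto with computable.
Qed.

Lemma computable1_decision : computable1 decision.
Proof.
have HP := computable1_decision_prefix; have HI := computable1_decision_image.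
by apply: computable1_sub; auto with computable.
Qed.

Lemma decisionE n : decision n = (decision_image n == decision_prefix n).
Proof. by rewrite /decision; case: eqP; lia. Qed.

(** * Sections and fixed rays *)

Lemma word_value_gen (G : groupType) k (X : 'I_k -> G) w :
  gen_subgroup (range X) (word_value X w).
Proof.
move=> H [[H1 HM _] XH]; rewrite /word_value.
elim/big_ind: _ => // i _; apply: XH; by exists i.
Qed.

Lemma word_value_act d k (X : 'I_k -> tree_aut d) w u :
  word_value X w u = foldl (fun u i => X i u) u w.
Proof.
rewrite /word_value; elim: w u => [|i w IH] u; first by rewrite big_nil.
by rewrite big_cons /= -IH.
Qed.

(** [g] acts after [f], so its section is taken at the image of [v]. *)
Lemma sections_mul d (f g : tree_aut d) v :
  tree_aut_mul f g @@ v = tree_aut_mul (f @@ v) (g @@ f v).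
Proof. by apply/esym/tree_section_unique => u /=; rewrite -!tree_sectionE. Qed.

(** By [sections_mul], each section is a section of the first letter times a section of the
    remaining product, so every letter multiplies the bound by [K]. *)
Lemma sections_word_value d k (X : 'I_k -> tree_aut d) K w :
  (forall i, exists2 s : seq (tree_aut d), size s <= K & forall v, X i @@ v \in s) ->
  exists2 s : seq (tree_aut d), size s <= K ^ size w &
    forall v, word_value X w @@ v \in s.
Proof.
move=> XK; rewrite /word_value; elim: w => [|i w [s sK ws]].
  exists [:: word_value X [::]] => // v; rewrite big_nil inE /word_value big_nil.
  apply/eqP/esym/tree_section_unique => u; exact: erefl.
have [t tK it] := XK i.
exists [seq tree_aut_mul f g | f <- t, g <- s].
  by rewrite size_allpairs expnS leq_mul.
move=> v; rewrite big_cons [_ @@ v]sections_mul.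
apply/allpairsP; exists (X i @@ v, (\prod_(j <- w) X j)%g @@ X i v).
by split; [exact: it | exact: ws | exact: erefl].
Qed.

Lemma presents_sections d (A : automaton d) f : presents A f ->
  exists2 s : seq (tree_aut d), size s <= nstates A & forall v, f @@ v \in s.
Proof.
move=> [st [_ Est _]]; exists [seq st q | q <- enum 'I_(nstates A)].
  by rewrite size_map size_enum_ord.
move=> v; have : sections f (f @@ v) by exists v.
by rewrite -Est => -[q _ <-]; apply: map_f; rewrite mem_enum.
Qed.

Lemma mkseqS (T : Type) (f : nat -> T) n : mkseq f n.+1 = f 0 :: mkseq (f \o S) n.
Proof. by rewrite /mkseq /= -[1]addn0 iotaDl -map_comp. Qed.

Lemma flatten_nseqSr (T : Type) j (s : seq T) :
  flatten (nseq j.+1 s) = flatten (nseq j s) ++ s.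
Proof. by elim: j => [|j IH] /=; rewrite ?cats0// -catA -IH. Qed.

Lemma foldl_map (T1 T2 R : Type) (h : T2 -> T1) (f : R -> T1 -> R) z s :
  foldl f z (map h s) = foldl (fun z x => f z (h x)) z s.
Proof. by elim: s z => /=. Qed.

Lemma ray_act_fixedP d (eta : ray d) (g : tree_aut d) :
  ray_act eta g = eta <-> forall n, g (mkseq eta n) = mkseq eta n.
Proof.
split=> [E n|H]; first by rewrite -mkseq_ray_act E.
by apply/funext => n; rewrite /ray_act H nth_mkseq.
Qed.

(** Automorphisms preserve lengths and prefixes, so a fixed word has only fixed prefixes. *)
Lemma fixed_mkseq_le d (eta : ray d) (g : tree_aut d) m n : m <= n ->
  g (mkseq eta n) = mkseq eta n -> g (mkseq eta m) = mkseq eta m.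
Proof.
move=> /subnKC <-; rewrite /mkseq iotaD map_cat tree_sectionE => /eqP.
by rewrite eqseq_cat ?size_tree_aut// => /andP[/eqP].
Qed.

Section FixedRay.
Variables (d : nat) (b : seq 'I_d) (b_gt0 : 0 < size b).
Implicit Types a : seq 'I_d.

(** This is [b^omega = b b^omega]: one period is unrolled into the preperiod. *)
Lemma evper_ray_nil : evper_ray [::] b_gt0 = evper_ray b b_gt0.
Proof.
apply/funext => m; rewrite /evper_ray /= subn0; case: ltnP => [mb|/subnKC{1}<-].
  by rewrite modn_small.
by rewrite modnDl.
Qed.

Lemma mkseq_evper_ray a m :
  mkseq (evper_ray a b_gt0) (size a + m) = a ++ mkseq (evper_ray [::] b_gt0) m.
Proof. by elim: a => //= c a IH; rewrite addSn mkseqS -IH. Qed.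

Lemma mkseq_evper_ray_period a j :
  mkseq (evper_ray a b_gt0) (size a + j * size b) = a ++ flatten (nseq j b).
Proof.
rewrite mkseq_evper_ray; congr (_ ++ _); elim: j => // j IH.
by rewrite mulSn evper_ray_nil mkseq_evper_ray IH.
Qed.

(* By pigeonhole the sections of g along a b^j, j < size S, already exhaust all
   those along the ray, as each determines the next. *)
Lemma evper_ray_fixedP a (g : tree_aut d) (S : seq (tree_aut d)) B :
  (forall v, g @@ v \in S) -> size a + size S * size b <= B ->
  ray_act (evper_ray a b_gt0) g = evper_ray a b_gt0 <->
  g (mkseq (evper_ray a b_gt0) B) = mkseq (evper_ray a b_gt0) B.
Proof.
move=> gS le_B; split=> [/ray_act_fixedP//|].
move=> /(fixed_mkseq_le le_B) fixS; apply/ray_act_fixedP => n.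
pose next (h : tree_aut d) := h @@ b.
have nextE j : iter j next (g @@ a) = g @@ (a ++ flatten (nseq j b)).
  elim: j => [|j IH]; first by rewrite cats0.
  by rewrite iterS IH flatten_nseqSr /next tree_section_cat catA.
(* The first [(size S).+1] iterates all lie in [S], so two of them coincide. *)
have loop : looping next (g @@ a) (size S).
  rewrite -[looping _ _ _]negbK -looping_uniq; apply/negP => /uniq_leq_size.
  move=> /(_ S); rewrite size_traject ltnn => H; apply: notF; apply: H => h.
  by case/trajectP => j _ ->; rewrite nextE.
(* The fixed prefix contains [a b^(j+1)]; cancelling the image of [a b^j] leaves the action of the
   section on [b]. *)
have fix_lt j : j < size S -> iter j next (g @@ a) b = b.
  move=> jS; have := @fixed_mkseq_le _ (evper_ray a b_gt0) g (size a + j.+1 * size b)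
    (size a + size S * size b).
  rewrite leq_add2l leq_mul2r jS orbT => /(_ isT fixS).
  rewrite mkseq_evper_ray_period flatten_nseqSr catA tree_sectionE -nextE => /eqP.
  by rewrite eqseq_cat ?size_tree_aut// => /andP[_ /eqP].
have fix_all j : iter j next (g @@ a) b = b.
  by have /loopingP/(_ j)/trajectP[i iS ->] := loop; exact: fix_lt.
(* As [b] is nonempty, [n] periods cover the first [n] letters. *)
apply: (@fixed_mkseq_le _ _ _ _ (size a + n * size b)).
  by rewrite (leq_trans _ (leq_addl _ _))// leq_pmulr.
rewrite mkseq_evper_ray_period; elim: n => [|j IH].
  rewrite -mkseq_evper_ray_period; apply: fixed_mkseq_le fixS.
  by rewrite leq_add2l leq_mul2r leq0n orbT.
by rewrite flatten_nseqSr catA tree_sectionE IH -nextE fix_all.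
Qed.

End FixedRay.

(** * Correctness *)

Lemma code_automaton_next d (A : automaton d) (q : 'I_(nstates A)) (c : 'I_d) :
  code_nth c (code_nth q (code_nth 2 (code_automaton A))) =
  cantor_pair (Defs.next q c) (output q c).
Proof.
rewrite /code_automaton code_nthE// [nth 0 _ 2]/=.
rewrite code_nthE 1?size_map ?size_enum_ord//.
rewrite (nth_map q) ?size_enum_ord//.
rewrite nth_ord_enum code_nthE 1?size_map ?size_enum_ord//.
by rewrite (nth_map c) ?size_enum_ord// nth_ord_enum.
Qed.

(** Induction on [u] from an arbitrary state [q] and output so far: started in [q], the transducer
    computes the section [st q]. *)
Lemma code_transduceE d (A : automaton d) f u : presents A f ->
  code_transduce (code_automaton A) (code_word u) = code_word (f u).
Proof.
move=> [st [stI _ stP]]; rewrite /code_transduce /code_word code_foldlE.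
set step := fun z c => _; rewrite foldl_map.
suff E q s : foldl (fun z c => step z (val c)) (cantor_pair (val q) (code_seq s)) u =
    cantor_pair (val (foldl (@Defs.next d A) q u))
      (code_seq (rev [seq val c | c <- st q u] ++ s)).
  have -> : code_nth 1 (code_automaton A) = val (init A) by rewrite /code_automaton code_nthE.
  by rewrite -[0]/(code_seq [::]) E cantor_pairK2 cats0 code_revE revK stI.
elim: u q s => [|c u IH] q s; first by rewrite tree_aut_root.
have [out sec] := stP q c.
rewrite -[c :: u]/([:: c] ++ u) tree_sectionE out sec /= rev_cons cat_rcons -IH.
congr (foldl _ _ u); rewrite /step cantor_pairK1 cantor_pairK2.
by rewrite code_automaton_next cantor_pairK1 cantor_pairK2.
Qed.

(** Induction on [m] with [a] arbitrary: once its first letter is written, the tail of [a] serves as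
    the new preperiod. *)
Lemma code_prefixE d m (a b : seq 'I_d) (b_gt0 : 0 < size b) :
  code_prefix m (code_word a) (code_word b) =
  code_word (mkseq (evper_ray a b_gt0) m).
Proof.
rewrite /code_prefix; set step := fun z => _.
suff E s : unpair2 (iter m step (cantor_pair (code_word a) (code_seq s))) =
    code_seq (rev [seq val c | c <- mkseq (evper_ray a b_gt0) m] ++ s).
  by rewrite -[0]/(code_seq [::]) E cats0 code_revE revK.
have stepE c (u : seq 'I_d) t : step (cantor_pair (code_word (c :: u)) t) =
    cantor_pair (code_word u) (code_cons (val c) t).
  by rewrite /step cantor_pairK1 cantor_pairK2 /code_word /= code_behead_cons code_head_cons.
(* A nonempty [b] has a nonzero code, so a start from [b] is not itself taken for an exhausted
   word. *)
have step0 t : step (cantor_pair (code_word [::]) t) = step (cantor_pair (code_word b) t).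
  by rewrite /step !cantor_pairK1 !cantor_pairK2 /=; case: (b) b_gt0.
elim: m a s => [|m IH] a s; first by rewrite cantor_pairK2.
have consE c u : unpair2 (iter m step (step (cantor_pair (code_word (c :: u)) (code_seq s)))) =
    code_seq (rev [seq val x | x <- mkseq (evper_ray (c :: u) b_gt0) m.+1] ++ s).
  by rewrite stepE -[code_cons _ _]/(code_seq (val c :: s)) IH mkseqS /= rev_cons cat_rcons.
rewrite iterSr; case: a => [|c a]; last exact: consE.
have [c [u Eb]] : exists c u, b = c :: u by case: (b) (b_gt0) => // c u; exists c, u.
by rewrite step0 evper_ray_nil; have := consE c u; rewrite -Eb.
Qed.

Lemma code_word_inj d : injective (@code_word d).
Proof. by move=> u v /code_seq_inj /(inj_map val_inj). Qed.

Lemma decision_lengthE n : decision_length n = n + n * n ^ n.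
Proof. by rewrite /decision_length iter_muln_1. Qed.

(** * The decision procedure on a coded input *)

Section Decision.
Variables (d k : nat) (X : 'I_k -> tree_aut d) (A : 'I_k -> automaton d).
Variables (w : seq 'I_k) (a b : seq 'I_d) (b_gt0 : 0 < size b).
Hypothesis AX : forall i, presents (A i) (X i).

Let n := code_input A w a b.

Lemma decision_prefixE :
  decision_prefix n = code_word (mkseq (evper_ray a b_gt0) (decision_length n)).
Proof. by rewrite /decision_prefix {2 3}/n /code_input !code_nthE//= code_prefixE. Qed.

Lemma decision_imageE : decision_image n =
  code_word (word_value X w (mkseq (evper_ray a b_gt0) (decision_length n))).
Proof.
rewrite /decision_image decision_prefixE; move: (mkseq _ _) => u.
rewrite /n /code_input !code_nthE//= /code_word code_foldlE foldl_map word_value_act.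
rewrite -!/(code_word _); elim: w u => //= i v IH u.
rewrite code_nthE 1?size_map ?size_enum_ord// (nth_map i) ?size_enum_ord//.
by rewrite nth_ord_enum (code_transduceE _ (AX i)).
Qed.

(** A code exceeds every entry of its sequence, so [n] exceeds the lengths of [w], [a], [b] and all
    numbers of states, hence may replace each of them in the bound. *)
Lemma decision_length_ge :
  exists2 S : seq (tree_aut d), forall v, word_value X w @@ v \in S &
    size a + size S * size b <= decision_length n.
Proof.
have in_n x : x \in [:: d; code_seq [seq code_automaton (A i) | i <- enum 'I_k];
    code_word w; code_word a; code_word b] -> x < n by exact: mem_code_seq.
have word_n m (u : seq 'I_m) : code_word u < n -> size u < n.
  by apply: leq_ltn_trans; have := size_code_seq [seq val c | c <- u]; rewrite size_map.
have sX i : exists2 s : seq (tree_aut d), size s <= n & forall v, X i @@ v \in s.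
  have [s s_le Hs] := presents_sections (AX i); exists s => //.
  apply: leq_trans s_le _.
  have lt1 : nstates (A i) < code_automaton (A i) by apply: mem_code_seq; rewrite inE eqxx.
  have lt2 : code_automaton (A i) < code_seq [seq code_automaton (A i) | i <- enum 'I_k].
    by apply: mem_code_seq; apply: map_f; rewrite mem_enum.
  apply/ltnW/(ltn_trans lt1)/(ltn_trans lt2).
  by apply: in_n; rewrite !inE eqxx orbT.
have [S S_le HS] := sections_word_value w sX.
exists S => //; rewrite decision_lengthE.
have w_n : size w < n by apply: word_n; apply: in_n; rewrite !inE eqxx ?orbT.
have a_n : size a < n by apply: word_n; apply: in_n; rewrite !inE eqxx ?orbT.
have b_n : size b < n by apply: word_n; apply: in_n; rewrite !inE eqxx ?orbT.
rewrite leq_add ?(ltnW a_n)// mulnC leq_mul ?(ltnW b_n)//.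
(* Monotonicity in the exponent needs a positive base; [n] is positive because it exceeds the length
   of [a]. *)
by rewrite (leq_trans S_le)// leq_pexp2l ?(ltnW w_n)// (leq_ltn_trans _ a_n).
Qed.

(** Every word has its value in the generated group, so only fixing the ray is at stake; by
    injectivity of the coding, equal codes mean a fixed prefix. *)
Lemma decisionP :
  decision n = 1 <-> WP X (Stab (gen_subgroup (range X)) (evper_ray a b_gt0)) w.
Proof.
have [S HS le_S] := decision_length_ge.
have fixP := evper_ray_fixedP b_gt0 HS le_S.
rewrite decisionE decision_imageE decision_prefixE (inj_eq (@code_word_inj d)).
split=> [|[_ /fixP ->]]; last by rewrite eqxx.
by case: eqP => // /fixP ? _; split=> //; exact: word_value_gen.
Qed.

End Decision.

Theorem proposition2p2 :
  exists f : recfun 1,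
  forall (d : nat) (k : nat) (X : 'I_k -> tree_aut d) (A : 'I_k -> automaton d)
    (w : seq 'I_k) (a b : seq 'I_d) (b_gt0 : 0 < size b),
    2 <= d ->
    symmetric_set (range X) ->
    (forall i, automaton_automorphism (X i)) ->
    (forall i, presents (A i) (X i)) ->
    decides_at f (code_input A w a b)
      (WP X (Stab (gen_subgroup (range X)) (evper_ray a b_gt0)) w).
Proof.
have [f Hf] := computable1_decision; exists f => d k X A w a b b_gt0 _ _ _ AX.
have := Hf [tuple code_input A w a b]; rewrite [nth 0 _ 0]/=.
have := decisionP w a b_gt0 AX.
(* As only two values occur, failing to be 1 already yields the answer 0. *)
have : decision (code_input A w a b) = 0 \/ decision (code_input A w a b) = 1.
  by rewrite decisionE; case: (_ == _); [right|left].
by case=> -> [to_WP of_WP] eval; split=> // H; [have := of_WP H | case: H; exact: to_WP].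
Qed.
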